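(* Let $d\ge 1$ and $n>d$ be integers. If $n\equiv a\pmod d$ where $a\ge 2$, then $$\mathrm{gp}(\mathrm{Circ}(n,\{1,2,\ldots,d\}))\ge \left\lceil \frac{d+1}{a}\right\rceil .$$
   Context: $\mathrm{Circ}(n,C)$ is the circulant digraph with vertex set $\mathbb{Z}_n$ and an arc from $x$ to $x+c \pmod n$ for every $x\in\mathbb{Z}_n$ and $c\in C$. For a digraph $D$, a set $S\subseteq V(D)$ is in general position if for any $u,v\in S$ no shortest directed $u,v$-path in $D$ passes through a vertex of $S\setminus\{u,v\}$; the general position number $\mathrm{gp}(D)$ is the maximum cardinality of a general position set of $D$. *)

(* Defs.v *)
From mathcomp Require Import all_boot all_order all_algebra.
From mathcomp Require Import boolp.

Set Implicit Arguments.
Unset Strict Implicit.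
Unset Printing Implicit Defensive.

Section GeneralPosition.

Variables (V : finType) (D : rel V).

(* A path is given by its initial vertex [u] and the sequence [p] of the vertices that follow,
   so its vertices are [u :: p] and its length is [size p]. *)
Definition dipath (u v : V) (p : seq V) : bool :=
  [&& path D u p, last u p == v & uniq (u :: p)].

Definition shortest_dipath (u v : V) (p : seq V) : Prop :=
  dipath u v p /\ (forall q : seq V, dipath u v q -> size p <= size q).

Definition general_position (S : {set V}) : Prop :=
  forall u v : V, u \in S -> v \in S ->
  forall p : seq V, shortest_dipath u v p ->
  forall w : V, w \in S :\: [set u; v] -> w \notin u :: p.

Definition gp : nat := \max_(S : {set V} | `[< general_position S >]) #|S|.

End GeneralPosition.

(* Residues modulo [n] are represented by ['I_n] rather than ['Z_n], which has the right
   cardinality only for [1 < n]. *)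
Definition Circ (n : nat) (C : seq nat) : rel 'I_n :=
  fun x y => has (fun c => y == x + c %[mod n]) C.

Arguments Circ n C : clear implicits.

(* Main.v *)
Require Import Defs.
From mathcomp Require Import all_boot all_order all_algebra.
From mathcomp Require Import boolp zify.

(** The multiples of [a] in the window [0, d] form a general position set, and
    there are [d %/ a + 1] of them, which is the ceiling of [(d + 1) / a].

    Suppose that two of them are distinct, so that [a <= d] and [n = q * d + a]
    with [q >= 1].  Going up inside the window costs a single arc, since the gap
    is at most [d]; a path with one arc has no interior vertex.  Going down from
    [x] to [y < x] means going round the circle, an advance of [n - (x - y)],
    where [a <= x - y <= d].  Each arc advances by at most [d], so
    [x - y <= d < d + a] makes at least [q] arcs necessary
    ([descending_path_size]), and [a <= x - y] makes [q] arcs sufficient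
    ([short_path]).  A shortest path from [u] down to [v] thus has [q] arcs; but
    if it passed through a third point [w] of the set, then one of its two
    proper pieces would itself be descending, the first if [w < u] and the
    second if [u < w] (as then [v < w]), and would already need [q] arcs. *)

Set Implicit Arguments.
Unset Strict Implicit.
Unset Printing Implicit Defensive.

Import Order.TTheory GRing.Theory Num.Theory.
Local Open Scope ring_scope.

Lemma Circ_iotaP (n d : nat) (x y : 'I_n) :
  reflect (exists2 c : nat, (0 < c <= d)%N & y = x + c %[mod n])
          (Circ n (iota 1 d) x y).
Proof.
apply: (iffP hasP) => [[c]|[c cd yE]].
  by rewrite mem_iota add1n ltnS => cd /eqP yE; exists c.
by exists c; rewrite ?mem_iota ?add1n ?ltnS //; apply/eqP.
Qed.

Lemma path_advance (n d : nat) (p : seq 'I_n) (x : 'I_n) :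
  path (Circ n (iota 1 d)) x p ->
  exists2 m : nat, (m <= size p * d)%N & last x p = x + m %[mod n].
Proof.
elim: p x => [|y p IHp] x /=; first by exists 0; rewrite ?addn0.
case/andP=> /Circ_iotaP[c /andP[_ cd] yE] /IHp[m mp ->].
exists (c + m)%N; first by rewrite mulSn leq_add.
by rewrite -modnDml yE modnDml addnA.
Qed.

(** Advancing greedily, by [d] as long as at least [d] remains, wastes no arc.
    Nothing is claimed about repeated vertices, because
    [shortest_dipath_min] compares shortest paths with arbitrary walks. *)
Lemma short_path (n d s m : nat) (x y : 'I_n) :
  (m <= s * d)%N -> y = x + m %[mod n] ->
  exists p : seq 'I_n,
    [/\ path (Circ n (iota 1 d)) x p, last x p = y & (size p <= s)%N].
Proof.
elim: s m x => [|s IHs] m x ms yE; have [m0|m_gt0] := posnP m.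
- exists [::]; split=> //=; apply/val_inj => /=.
  by move: yE; rewrite m0 addn0 !modn_small.
- by move: ms; rewrite mul0n leqNgt m_gt0.
- exists [::]; split=> //=; apply/val_inj => /=.
  by move: yE; rewrite m0 addn0 !modn_small.
have n_gt0 : (0 < n)%N by apply: leq_ltn_trans (ltn_ord x).
pose c := minn m d.
pose z := Ordinal (ltn_pmod (x + c) n_gt0).
have [||p [zp zy ps]] := IHs (m - c)%N z; first by rewrite /c; lia.
  by rewrite yE /= modnDml -addnA subnKC // geq_minl.
exists (z :: p); split=> //=; rewrite zp andbT.
apply/Circ_iotaP; exists c; last by rewrite /= modn_mod.
(* [c] is positive, since [d = 0] would force [m = 0]. *)
by rewrite /c; move: ms; case: (d) => [|d']; lia.
Qed.

(** Deleting the loops of a walk turns it into a path that is no longer, so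
    lengths of arbitrary walks bound those of shortest paths. *)
Lemma shortest_dipath_min (V : finType) (D : rel V) (u v : V) (p q : seq V) :
  shortest_dipath D u v p -> path D u q -> last u q = v ->
  (size p <= size q)%N.
Proof.
case=> _ pmin uq qv; move: qv; case/shortenP: uq => q' uq' Uq' sub_q' q'v.
have /andP[_ Uq'_tail] := Uq'.
apply: leq_trans (uniq_leq_size Uq'_tail sub_q'); apply: pmin.
by rewrite /dipath uq' q'v eqxx.
Qed.

(** Fewer than [q] arcs advance by at most [(q - 1) * d = n - a - d]; starting
    at most [d] past vertex [0], the path has not come back to [0] and so is
    still at or above its origin. *)
Lemma descending_path_size (n d a q : nat) (x y : 'I_n) (p : seq 'I_n) :
  n = (q * d + a)%N -> (0 < a)%N -> (y < x)%N -> (x <= d)%N ->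
  path (Circ n (iota 1 d)) x p -> last x p = y -> (q <= size p)%N.
Proof.
move=> nE a_gt0 yx xd /path_advance[m mp yE] lastE; rewrite leqNgt.
apply/negP => pq.
have m_small : (m + d <= q * d)%N.
  by apply: leq_trans (leq_mul pq (leqnn d)); rewrite mulSn addnC leq_add2l.
move: yE; rewrite lastE [in RHS]modn_small; last by lia.
by rewrite modn_small //; lia.
Qed.

Definition window_multiples (n d a : nat) : {set 'I_n} :=
  [set v : 'I_n | (v <= d)%N && (a %| v)%N].

Lemma card_window_multiples (n d a : nat) : (d < n)%N -> (0 < a)%N ->
  (d %/ a < #|window_multiples n d a|)%N.
Proof.
move=> dn a_gt0.
have bnd (i : 'I_(d %/ a).+1) : (i * a <= d)%N.
  by rewrite -leq_divRL // -ltnS.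
pose f i := Ordinal (leq_ltn_trans (bnd i) dn).
have f_inj : injective f.
  move=> i j /(congr1 val) /= /eqP; rewrite eqn_pmul2r // => /eqP.
  exact: val_inj.
rewrite -[X in (X <= _)%N]card_ord -(card_imset _ f_inj).
apply/subset_leq_card/subsetP => _ /imsetP[i _ ->].
by rewrite inE /= bnd dvdn_mull.
Qed.

(** When [n = q * d + a] with [a <= d], the spacing [a] is the least for which
    [q] arcs always suffice to descend, and the width [d] of the window is the
    largest for which a single arc always suffices to ascend.  When [d < a], the
    set is reduced to the vertex [0]. *)
Lemma window_multiples_general_position (n d a : nat) :
  (d < n)%N -> (0 < a)%N -> n = a %[mod d] ->
  general_position (Circ n (iota 1 d)) (window_multiples n d a).
Proof.
move=> dn a_gt0 naE u v; rewrite !inE => /andP[ud au] /andP[vd av] p sp w.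
rewrite !inE !negb_or => /andP[/andP[wu wv] /andP[wd aw]].
rewrite (negPf wu) /=; apply/negP => wp.
have [/and3P[up /eqP pv _] _] := sp.
have [uv|vu|uv] := ltngtP u v.
- (* An ascending shortest path has one arc, hence no interior vertex. *)
  have [||r [ur rv rs]] := @short_path n d 1 (v - u) u v.
  + by rewrite mul1n; lia.
  + by rewrite subnKC // ltnW.
  have := leq_trans (shortest_dipath_min sp ur rv) rs.
  case: p wp pv {sp up} => [|z [|]] //=; rewrite inE => /eqP <- zv.
  by rewrite zv eqxx in wv.
- (* A descending shortest path has at most [q] arcs, too few for a detour. *)
  have a_le : (a <= u - v)%N.
    by apply: dvdn_leq; [rewrite subn_gt0 | apply: dvdn_sub].
  have a_led : (a <= d)%N by lia.
  have /dvdnP[q nE'] : (d %| n - a)%N.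
    by rewrite -eqn_mod_dvd; [apply/eqP | lia].
  have nE : n = (q * d + a)%N by lia.
  have [||r [ur rv rs]] := @short_path n d q (n - (u - v)) u v.
  + by lia.
  + have -> : (u + (n - (u - v)) = v + n)%N by have := ltn_ord u; lia.
    by rewrite modnDr.
  have pq := leq_trans (shortest_dipath_min sp ur rv) rs.
  case/splitPr: wp pv up pq {sp} => p1 p2.
  rewrite last_cat cat_path size_cat /= => p2v /and3P[up1 p1w wp2] pq.
  have p2_gt0 : (0 < size p2)%N.
    by case: (p2) p2v => //= wv'; rewrite wv' eqxx in wv.
  have [uw|wu'|uw] := ltngtP u w.
  + have := descending_path_size nE a_gt0 (ltn_trans vu uw) wd wp2 p2v.
    by move/(leq_trans pq); rewrite addnS ltnNge leq_addl.
  + have uw1 : path (Circ n (iota 1 d)) u (rcons p1 w) by rewrite rcons_path up1.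
    have := descending_path_size nE a_gt0 wu' ud uw1 (last_rcons _ _ _).
    rewrite size_rcons => /(leq_trans pq).
    by rewrite addnS ltnS -[leqRHS]addn0 leq_add2l leqNgt p2_gt0.
  + by rewrite (val_inj uw) eqxx in wu.
- (* The empty walk is the only shortest path from a vertex to itself. *)
  have := shortest_dipath_min (q := [::]) sp isT (val_inj uv).
  by case: (p) wp.
Qed.

Lemma leq_gp (V : finType) (D : rel V) (S : {set V}) :
  general_position D S -> (#|S| <= gp D)%N.
Proof.
move=> gS; apply: (@leq_bigmax_cond _ _ (fun S : {set V} => #|S|)).
exact/asboolP.
Qed.

Theorem theorem3p3 (d n a : nat) (hd : (1 <= d)%N) (hn : (d < n)%N)
  (ha : (2 <= a)%N) (hna : n = a %[mod d]) :
  Num.ceil (d.+1%:Q / a%:Q) <= (gp (Circ n (iota 1 d)))%:Z.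
Proof.
have a_gt0 : (0 < a)%N by apply: ltnW.
have card_gp := leq_trans (card_window_multiples hn a_gt0)
  (leq_gp (window_multiples_general_position hn a_gt0 hna)).
rewrite ceil_le_int ler_pdivrMr ?ltr0z ?ltz_nat //.
rewrite -intrM ler_int -PoszM lez_nat.
by apply: leq_trans (ltn_ceil d a_gt0) _; rewrite leq_mul2r card_gp orbT.
Qed.
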